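(* For all $i\geq 1$, $\mathbf{V}(S_{\mathbb{N}_i})\subsetneq\mathbf{V}(S_{\mathbb{N}_{i+1}})$, where $\mathbb{N}_i$ is the $i$-th nested-type 3-hypergraph.
   Context: A 3-uniform hypergraph $\mathbb{H}=(V,E)$ has a finite vertex set $V$ and a set $E$ of 3-element subsets of $V$ (hyperedges). All hypergraphs considered are linear (any two distinct hyperedges share at most one vertex) and every vertex lies in some hyperedge. A subhyperedge is a nonempty subset of a hyperedge. Two subhyperedges $e_1',e_2'$ are linked if there is a single vertex $w\notin e_1'\cup e_2'$ such that $e_1'\cup\{w\}$ and $e_2'\cup\{w\}$ are both hyperedges. The 3-hypergraph semigroup of $\mathbb{H}$ is the semigroup given by the presentation with generators $\mathbf{a}_u$ ($u\in V$) and $0$, and relations: $\mathbf{a}_u\mathbf{a}_v=\mathbf{a}_v\mathbf{a}_u$; $0\mathbf{a}_u=\mathbf{a}_u0=00=0$; $\mathbf{a}_u\mathbf{a}_v=0$ if $u=v$ or $\{u,v\}$ is not a subhyperedge; $\mathbf{a}_u\mathbf{a}_v\mathbf{a}_h=0$ if $\{u,v,h\}\notin E$; $\mathbf{a}_{u_i}\mathbf{a}_{u_j}=\mathbf{a}_{u_r}\mathbf{a}_{u_l}$ if $\{u_i,u_j\}$ and $\{u_r,u_l\}$ are linked; and for every hyperedge $\{u,v,w\}$, $\mathbf{a}_u\mathbf{a}_v\mathbf{a}_w=\mathbf{a}$, where $\mathbf{a}$ is one and the same (nonzero) element for all hyperedges. This semigroup with zero is 0-cancellative, and therefore becomes a semiring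 $S_{\mathbb{H}}$, called the 3-hypergraph semiring of $\mathbb{H}$, under the flat addition $x+x=x$ and $x+y=0$ for $x\ne y$. Nested-type 3-hypergraphs: for $i\ge1$, $\mathbb{N}_i$ has vertices $u_1,\dots,u_{3i+3}$ (pairwise distinct) and, for each $1\le k\le i$, the three hyperedges $\{u_{3k-1},u_{3k+3},u_{3k-2}\}$, $\{u_{3k-2},u_{3k+2},u_{3k}\}$, $\{u_{3k},u_{3k+1},u_{3k-1}\}$ (and no others). $\mathbf{V}(S)$ denotes the variety generated by the semiring $S$, in the signature $\{+,\cdot\}$ (both operations associative, $+$ commutative, $\cdot$ distributing over $+$ on both sides). *)

(* Defs.v *)
From HB Require Import structures.
From mathcomp Require Import all_boot zify boolp.

Set Implicit Arguments.
Unset Strict Implicit.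
Unset Printing Implicit Defensive.

(** * Semirings and varieties *)

(* No neutral elements: the signature is {+, *}.  As usual in universal
   algebra, carriers are nonempty. *)
Record semiring := Semiring {
  sr_car :> Type;
  sr_add : sr_car -> sr_car -> sr_car;
  sr_mul : sr_car -> sr_car -> sr_car;
  sr_inh : inhabited sr_car;
  sr_addA : associative sr_add;
  sr_addC : commutative sr_add;
  sr_mulA : associative sr_mul;
  sr_mulDl : left_distributive sr_mul sr_add;
  sr_mulDr : right_distributive sr_mul sr_add }.

Record sr_hom (A B : semiring) (f : A -> B) : Prop := SrHom {
  sr_homD : {morph f : x y / sr_add x y};
  sr_homM : {morph f : x y / sr_mul x y} }.

Section Product.
Variables (I : Type) (F : I -> semiring).

Definition prod_car := forall i, F i.
Definition prod_add (x y : prod_car) : prod_car := fun i => sr_add (x i) (y i).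
Definition prod_mul (x y : prod_car) : prod_car := fun i => sr_mul (x i) (y i).

Lemma prod_inh : inhabited prod_car.
Proof.
apply: inhabits => i; apply: (proj1_sig (@cid (F i) (fun=> True) _)).
by case: (sr_inh (F i)) => x; exists x.
Qed.

Lemma prod_addA : associative prod_add.
Proof.
by move=> x y z; apply: functional_extensionality_dep => i; exact: sr_addA.
Qed.

Lemma prod_addC : commutative prod_add.
Proof.
by move=> x y; apply: functional_extensionality_dep => i; exact: sr_addC.
Qed.

Lemma prod_mulA : associative prod_mul.
Proof.
by move=> x y z; apply: functional_extensionality_dep => i; exact: sr_mulA.
Qed.

Lemma prod_mulDl : left_distributive prod_mul prod_add.
Proof.
by move=> x y z; apply: functional_extensionality_dep => i; exact: sr_mulDl.
Qed.

Lemma prod_mulDr : right_distributive prod_mul prod_add.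
Proof.
by move=> x y z; apply: functional_extensionality_dep => i; exact: sr_mulDr.
Qed.

Definition prod_semiring : semiring :=
  Semiring prod_inh prod_addA prod_addC prod_mulA prod_mulDl prod_mulDr.

End Product.

(* Subalgebras are taken up to isomorphism, i.e. as sources of injective
   homomorphisms.  Classes of semirings are not of type [set semiring]: sets
   form eqTypes in MathComp-Analysis, so that would exclude carriers living in
   the universe of eqTypes, such as the quotient types below. *)
Record is_variety (K : semiring -> Prop) : Prop := IsVariety {
  variety_quo : forall (A B : semiring) (f : A -> B),
    sr_hom f -> (forall b, exists a, f a = b) -> K A -> K B;
  variety_sub : forall (A B : semiring) (f : A -> B),
    sr_hom f -> injective f -> K B -> K A;
  variety_prod : forall (I : Type) (F : I -> semiring),
    (forall i, K (F i)) -> K (prod_semiring F) }.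

Definition variety_gen (S : semiring) : semiring -> Prop :=
  fun T => forall K, is_variety K -> K S -> K T.

(** * Semigroup presentations *)

Section Presentation.
Variable G : choiceType.

(* The free semigroup on G: a nonempty word is its head and its tail. *)
Definition word : choiceType := (G * seq G)%type.

Definition letter (g : G) : word := (g, [::]).

Definition wmul (x y : word) : word := (x.1, x.2 ++ y.1 :: y.2).

Lemma wmulA : associative wmul.
Proof. by move=> x y z; rewrite /wmul /= -catA. Qed.

Variable R : word -> word -> Prop.

Inductive cong : word -> word -> Prop :=
  | cong_rel x y : R x y -> cong x y
  | cong_refl x : cong x x
  | cong_sym x y : cong x y -> cong y x
  | cong_trans y x z : cong x y -> cong y z -> cong x z
  | cong_mul x x' y y' : cong x x' -> cong y y' -> cong (wmul x y) (wmul x' y').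

Definition congb (x y : word) : bool := `[< cong x y >].

Lemma congb_refl : reflexive congb.
Proof. by move=> x; apply/asboolP; exact: cong_refl. Qed.

Lemma congb_sym : symmetric congb.
Proof. by move=> x y; apply/asboolP/asboolP => /cong_sym. Qed.

Lemma congb_trans : transitive congb.
Proof.
by move=> y x z /asboolP xy /asboolP yz; apply/asboolP; exact: cong_trans xy yz.
Qed.

Canonical congb_equiv := EquivRel congb congb_refl congb_sym congb_trans.

Definition presented := {eq_quot congb_equiv}%qT.
HB.instance Definition _ := Choice.on presented.

Definition cls (x : word) : presented := (\pi_({eq_quot congb_equiv}) x)%qT.

Definition pmul (x y : presented) : presented := cls (wmul (repr x) (repr y)).

Lemma clsP x y : cls x = cls y <-> cong x y.
Proof. by split=> [/eqmodP/asboolP|xy]; last exact/eqmodP/asboolP. Qed.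

Lemma clsK (x : presented) : cls (repr x) = x.
Proof. exact: reprK. Qed.

Lemma pmul_cls x y : pmul (cls x) (cls y) = cls (wmul x y).
Proof. by apply/clsP; apply: cong_mul; apply/clsP; rewrite clsK. Qed.

Lemma pmulA : associative pmul.
Proof.
by move=> x y z; rewrite -(clsK x) -(clsK y) -(clsK z) !pmul_cls wmulA.
Qed.

End Presentation.

(** * Flat semirings *)

Section Flat.
Variables (T : eqType) (mul : T -> T -> T) (z : T).

Definition zero_cancellative : Prop :=
  (forall a b c, mul a b = mul a c -> mul a b <> z -> b = c) /\
  (forall a b c, mul b a = mul c a -> mul b a <> z -> b = c).

Definition flat_add (x y : T) : T := if x == y then x else z.

Hypotheses (mulA : associative mul) (mul0 : left_zero z mul)
  (mulr0 : right_zero z mul) (canc : zero_cancellative).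

Lemma flat_addA : associative flat_add.
Proof.
move=> x y t; rewrite /flat_add; have [->|ne] := eqVneq y t.
  by have [->|_] := eqVneq x t; rewrite ?eqxx // if_same.
have -> : (if x == z then x else z) = z by case: eqP.
have [->|_] := eqVneq x y; first by rewrite (negPf ne).
by rewrite if_same.
Qed.

Lemma flat_addC : commutative flat_add.
Proof. by move=> x y; rewrite /flat_add eq_sym; case: eqP => [->|]. Qed.

Lemma flat_mulDl : left_distributive mul flat_add.
Proof.
move=> x y t; rewrite /flat_add; case: (eqVneq x y) => [->|/eqP ne].
  by rewrite eqxx.
rewrite mul0; case: eqP => // e; case: (eqVneq (mul x t) z) => // /eqP nz.
by case: ne; exact: (canc.2 _ _ _ e nz).
Qed.

Lemma flat_mulDr : right_distributive mul flat_add.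
Proof.
move=> x y t; rewrite /flat_add; case: (eqVneq y t) => [->|/eqP ne].
  by rewrite eqxx.
rewrite mulr0; case: eqP => // e; case: (eqVneq (mul x y) z) => // /eqP nz.
by case: ne; exact: (canc.1 _ _ _ e nz).
Qed.

Definition flat_semiring : semiring :=
  Semiring (inhabits z) flat_addA flat_addC mulA flat_mulDl flat_mulDr.

End Flat.

(** * Linear 3-uniform hypergraphs and their semirings *)

Record hypergraph3 := Hypergraph3 {
  vert : finType;
  hedges : {set {set vert}};
  hedges_card : forall e, e \in hedges -> #|e| = 3;
  hedges_linear : forall e f, e \in hedges -> f \in hedges -> e != f ->
    #|e :&: f| <= 1;
  hedges_cover : forall v, exists2 e, e \in hedges & v \in e }.

Section HypergraphSemiring.
Variable H : hypergraph3.
Notation V := (vert H).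
Notation E := (hedges H).

Definition subhyperedge (s : {set V}) : Prop :=
  s != set0 /\ exists2 e, e \in E & s \subset e.

Definition linked (s t : {set V}) : Prop :=
  [/\ subhyperedge s, subhyperedge t &
    exists w, [/\ w \notin s :|: t, w |: s \in E & w |: t \in E]].

(* [Some u] is the generator a_u and [None] is the generator 0. *)
Definition hgen : choiceType := option V.

Local Notation a u := (letter (Some u : hgen)).
Local Notation o := (letter (None : hgen)).
Local Notation "x ** y" := (wmul x y) (at level 40, left associativity).

Inductive hrel : word hgen -> word hgen -> Prop :=
  | hrel_comm u v : hrel (a u ** a v) (a v ** a u)
  | hrel_0l u : hrel (o ** a u) o
  | hrel_0r u : hrel (a u ** o) o
  | hrel_00 : hrel (o ** o) o
  | hrel_2 u v : u = v \/ ~ subhyperedge [set u; v] -> hrel (a u ** a v) o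
  | hrel_3 u v h : [set u; v; h] \notin E -> hrel (a u ** a v ** a h) o
  | hrel_linked ui uj ur ul : linked [set ui; uj] [set ur; ul] ->
      hrel (a ui ** a uj) (a ur ** a ul)
  | hrel_edge u v w u' v' w' : [set u; v; w] \in E -> [set u'; v'; w'] \in E ->
      hrel (a u ** a v ** a w) (a u' ** a v' ** a w').

Definition hsgp := presented hrel.
Definition hzero : hsgp := cls hrel o.
Definition ha (u : V) : hsgp := cls hrel (a u).
Definition hmul : hsgp -> hsgp -> hsgp := @pmul hgen hrel.

(* The semigroup is computed by a normal form: 0, the a_u, one product
   b_h = a_u a_v for each vertex h (with {u, v, h} a hyperedge), and the common
   value of the a_u a_v a_w over all hyperedges. *)
Inductive nform := N0 | N1 of V | N2 of V | N3.

Definition nmul (x y : nform) : nform :=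
  match x, y with
  | N1 u, N1 v => if [pick h | [set u; v; h] \in E] is Some h then N2 h else N0
  | N1 u, N2 h | N2 h, N1 u => if u == h then N3 else N0
  | _, _ => N0
  end.

Lemma edge_inj (u v w w' : V) :
  [set u; v; w] \in E -> [set u; v; w'] \in E -> w = w'.
Proof.
move=> e1 e2; apply/eqP/contraT => ne.
have c1 := hedges_card e1; have c2 := hedges_card e2.
have uv : u != v.
  by apply/eqP => uv; move: c1; rewrite uv setUid cards2; case: eqP.
have wn : w \notin [set u; v].
  by apply/negP => wi; move: c1; rewrite setUC (setUidPr _) ?sub1set // cards2 uv.
have ne' : [set u; v; w] != [set u; v; w'].
  apply/eqP => /setP/(_ w); rewrite !inE eqxx (negPf ne) orbT orbF.
  by move: wn; rewrite !inE => /negPf->.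
have := hedges_linear e1 e2 ne'.
suff : #|[set u; v]| <= #|[set u; v; w] :&: [set u; v; w']|.
  by rewrite cards2 uv => /leq_trans h /h.
by apply: subset_leq_card; rewrite subsetI !subsetUl.
Qed.

Lemma edge_rot (u v w : V) : [set u; v; w] = [set v; w; u].
Proof. by rewrite -setUA setUC. Qed.

Lemma edge_swap (u v w : V) : [set u; v; w] = [set v; u; w].
Proof. by congr (_ :|: _); rewrite setUC. Qed.

Lemma nmul11 (u v h : V) : [set u; v; h] \in E -> nmul (N1 u) (N1 v) = N2 h.
Proof.
move=> e /=; case: pickP => [h' e'|/(_ h)]; last by rewrite e.
by rewrite (edge_inj e e').
Qed.

Lemma nmul11P (u v : V) :
  (exists2 h, [set u; v; h] \in E & nmul (N1 u) (N1 v) = N2 h) \/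
  ((forall h, [set u; v; h] \notin E) /\ nmul (N1 u) (N1 v) = N0).
Proof.
rewrite /=; case: pickP => [h e|n]; first by left; exists h.
by right; split => // h; rewrite n.
Qed.

Lemma nmulC : commutative nmul.
Proof.
case=> [|u|h|] [|v|k|] //; have [[t e ->]|[n ->]] := nmul11P u v.
  by rewrite (@nmul11 v u t) // edge_swap.
by case: (nmul11P v u) => [[t]|[_ ->]] //; rewrite edge_swap (negPf (n t)).
Qed.

Lemma nmul111 (u v w : V) :
  nmul (N1 u) (nmul (N1 v) (N1 w)) = if [set u; v; w] \in E then N3 else N0.
Proof.
rewrite edge_rot; have [[t e ->]|[n ->]] := nmul11P v w.
  rewrite /nmul; case: (eqVneq u t) => [->|/eqP ne]; first by rewrite e.
  by case: ifP => // e'; case: ne; rewrite (edge_inj e e').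
by rewrite (negPf (n u)).
Qed.

Lemma nmulA : associative nmul.
Proof.
case=> [|u|h|] [|v|k|] [|w|l|] //=.
all: try by do ?[case: pickP => [? _|_] //= | case: eqP => _ //=].
rewrite -[LHS]/(nmul (N1 u) (nmul (N1 v) (N1 w))).
rewrite -[RHS]/(nmul (nmul (N1 u) (N1 v)) (N1 w)).
by rewrite [RHS]nmulC !nmul111 -edge_rot.
Qed.

Definition ngen (g : hgen) : nform := if g is Some u then N1 u else N0.

Fixpoint neval_seq (g : hgen) (s : seq hgen) : nform :=
  if s is g' :: s' then nmul (ngen g) (neval_seq g' s') else ngen g.

Definition neval (x : word hgen) : nform := neval_seq x.1 x.2.

Lemma nevalM x y : neval (x ** y) = nmul (neval x) (neval y).
Proof.
case: x => g s; case: y => g' s'; rewrite /neval /=.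
by elim: s g => //= g1 s IH g; rewrite IH nmulA.
Qed.

Lemma neval_rel x y : hrel x y -> neval x = neval y.
Proof.
case=> [u v|u|u||u v uv|u v h n|ui uj ur ul [_ _ [w [_ e1 e2]]]|u v w u' v' w' e e'].
- by rewrite !nevalM nmulC.
- by rewrite !nevalM.
- by rewrite !nevalM.
- by rewrite !nevalM.
- rewrite nevalM -[LHS]/(nmul (N1 u) (N1 v)).
  have [[h e _]|[_ ->]] // := nmul11P u v; case: uv => [uv|[]].
    by have := hedges_card e; rewrite uv setUid cards2; case: eqP.
  split; last by exists [set u; v; h]; rewrite ?subsetUl.
  by apply/set0Pn; exists u; rewrite !inE eqxx.
- by rewrite !nevalM -nmulA nmul111 (negPf n).
- rewrite !nevalM -[LHS]/(nmul (N1 ui) (N1 uj)) -[RHS]/(nmul (N1 ur) (N1 ul)).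
  by rewrite (@nmul11 ui uj w) 1?setUC // (@nmul11 ur ul w) // setUC.
- by rewrite !nevalM -!nmulA !nmul111 e e'.
Qed.

Lemma neval_cong x y : cong hrel x y -> neval x = neval y.
Proof.
elim=> {x y} [x y /neval_rel//|//|//|y x z _ -> //|x x' y y' _ h _ k].
by rewrite !nevalM h k.
Qed.

Local Notation "x ~ y" := (cong hrel x y) (at level 70).

Lemma cong_mull x y y' : y ~ y' -> x ** y ~ x ** y'.
Proof. by move=> h; apply: cong_mul => //; exact: cong_refl. Qed.

Lemma cong_mulr x x' y : x ~ x' -> x ** y ~ x' ** y.
Proof. by move=> h; apply: cong_mul => //; exact: cong_refl. Qed.

Lemma cong_gen0 g : letter g ** o ~ o.
Proof. by case: g => [u|]; apply: cong_rel; constructor. Qed.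

Lemma cong_0gen g : o ** letter g ~ o.
Proof. by case: g => [u|]; apply: cong_rel; constructor. Qed.

Lemma word_cons g g' (s : seq hgen) : (g, g' :: s) = letter g ** (g', s).
Proof. by []. Qed.

Lemma cong_0w x : o ** x ~ o.
Proof.
case: x => g s; elim: s g => [|g' s IH] g; first exact: cong_0gen.
rewrite word_cons wmulA; apply: (cong_trans (y := o ** (g', s))) => //.
exact/cong_mulr/cong_0gen.
Qed.

Lemma cong_aa u v : (forall h, [set u; v; h] \notin E) -> a u ** a v ~ o.
Proof.
move=> n; apply/cong_rel/hrel_2.
have [uv|/eqP uv] := eqVneq u v; [by left | right => -[_ [e eE se]]].
have : 0 < #|e :\: [set u; v]|.
  by rewrite cardsD (setIidPr se) (hedges_card eE) cards2; case: eqP.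
case/card_gt0P => h; rewrite inE => /andP[hn he].
have /negP[] := n h; suff -> : [set u; v; h] = e by [].
apply/eqP; rewrite eqEcard subUset se sub1set he /= (hedges_card eE).
by rewrite setUC cardsU1 hn cards2; move/eqP: uv => ->.
Qed.

Lemma cong_aa0 u : a u ** a u ~ o.
Proof. by apply/cong_rel/hrel_2; left. Qed.

Lemma neval_reduce x :
  match neval x with
  | N0 => x ~ o
  | N1 u => x ~ a u
  | N2 h => exists u v, [set u; v; h] \in E /\ x ~ a u ** a v
  | N3 => exists u v w, [set u; v; w] \in E /\ x ~ a u ** a v ** a w
  end.
Proof.
case: x => g s; elim: s g => [|g' s IH] g.
  by case: g => [u|]; exact: cong_refl.
rewrite word_cons nevalM; set y := (g', s) in IH *.
case: g => [u|]; last exact: cong_0w.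
rewrite -[neval (letter _)]/(N1 u).
move: (IH g'); rewrite -/y; case: (neval y) => [|v|h|].
- by move=> h; apply: cong_trans (cong_gen0 (Some u)); exact: cong_mull.
- move=> yv; have yv' := @cong_mull (a u) _ _ yv.
  have [[h e ->]|[n ->]] := nmul11P u v; first by exists u, v.
  exact: cong_trans yv' (cong_aa n).
- case=> v [w [e yvw]]; have y' := @cong_mull (a u) _ _ yvw.
  rewrite wmulA in y'; rewrite /nmul; case: (eqVneq u h) => [uh|/eqP ne].
    by exists u, v, w; split => //; rewrite edge_rot uh.
  apply: cong_trans y' _; apply/cong_rel/hrel_3/negP; rewrite edge_rot => e'.
  exact/ne/(edge_inj e' e).
- case=> v [w [t [e yvw]]]; have y' := @cong_mull (a u) _ _ yvw.
  rewrite !wmulA in y'; apply: cong_trans y' _.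
  have [e'|ne] := boolP ([set u; v; w] \in E); last first.
    by apply: cong_trans (cong_0w (a t)); apply/cong_mulr/cong_rel/hrel_3.
  have tu : t = u by apply: (edge_inj e); rewrite -edge_rot.
  move: e yvw; rewrite {t}tu => e _; rewrite -!wmulA.
  apply: (cong_trans (y := a u ** (a u ** a v ** a w))).
    by apply: cong_mull; rewrite wmulA; apply/cong_rel/hrel_edge.
  rewrite !wmulA -wmulA; apply: cong_trans (cong_0w (a v ** a w)).
  exact/cong_mulr/cong_aa0.
Qed.

Lemma nevalP x y : cong hrel x y <-> neval x = neval y.
Proof.
split=> [/neval_cong//|]; have := neval_reduce x; have := neval_reduce y.
move=> + + exy; rewrite exy; case: (neval y) => [|u|h|].
- by move=> hy hx; exact/(cong_trans hx)/cong_sym.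
- by move=> hy hx; exact/(cong_trans hx)/cong_sym.
- case=> u [v [e hy]] [u' [v' [e' hx]]]; apply: cong_trans hx _.
  apply: cong_trans (cong_sym hy); apply/cong_rel/hrel_linked.
  have sub p q : [set p; q; h] \in E -> subhyperedge [set p; q].
    move=> ee; split; last by exists [set p; q; h]; rewrite ?subsetUl.
    by apply/set0Pn; exists p; rewrite !inE eqxx.
  have nin p q : [set p; q; h] \in E -> h \notin [set p; q].
    move=> ee; apply/negP => hi; have := hedges_card ee.
    by rewrite setUC (setUidPr _) ?sub1set // cards2; case: eqP.
  split; [exact: sub e'|exact: sub e|exists h; split].
  + by rewrite inE negb_or (nin _ _ e) (nin _ _ e').
  + by rewrite setUC.
  + by rewrite setUC.
- case=> u [v [w [e hy]]] [u' [v' [w' [e' hx]]]]; apply: cong_trans hx _.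
  by apply: cong_trans (cong_sym hy); apply/cong_rel/hrel_edge.
Qed.

Definition hval (x : hsgp) : nform := neval (repr x).

Lemma hval_cls x : hval (cls hrel x) = neval x.
Proof. by apply/nevalP/clsP; rewrite clsK. Qed.

Lemma hval_inj : injective hval.
Proof. by move=> x y /nevalP/clsP; rewrite !clsK. Qed.

Lemma hvalM : {morph hval : x y / hmul x y >-> nmul x y}.
Proof. by move=> x y; rewrite hval_cls nevalM. Qed.

Lemma hmulA : associative hmul.
Proof. exact: pmulA. Qed.

Lemma hmulC : commutative hmul.
Proof. by move=> x y; apply: hval_inj; rewrite !hvalM nmulC. Qed.

Lemma hmul0l : left_zero hzero hmul.
Proof. by move=> x; apply: hval_inj; rewrite hvalM hval_cls. Qed.

Lemma hmul0r : right_zero hzero hmul.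
Proof. by move=> x; rewrite hmulC hmul0l. Qed.

Lemma nmul_canc x y z : nmul x y = nmul x z -> nmul x y <> N0 -> y = z.
Proof.
case: x => [|u|h|] //; case: y => [|v|k|] //; case: z => [|w|l|] //.
- have [[s e ->]|[_ ->]] // := nmul11P u v.
  have [[t e' ->] [st] _|[_ ->]] // := nmul11P u w; rewrite -{t}st in e'.
  have h : v = w by apply: (@edge_inj s u); rewrite edge_rot.
  by rewrite h.
- by have [[s e ->]|[_ ->]] // := nmul11P u v; rewrite /nmul; case: eqP.
- by have [[s e ->]|[_ ->]] // := nmul11P u w; rewrite /nmul; case: eqP.
- by rewrite /nmul; case: eqP => // <-; case: eqP => // <-.
- by rewrite /nmul; case: eqP => // ->; case: eqP => // ->.
Qed.

Lemma hmul_canc : zero_cancellative hmul hzero.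
Proof.
have h x y z : hmul x y = hmul x z -> hmul x y <> hzero -> y = z.
  move=> e n; apply: hval_inj; apply: (@nmul_canc (hval x)).
    by rewrite -!hvalM e.
  by rewrite -hvalM => n0; apply/n/hval_inj; rewrite n0 hval_cls.
by split=> // x y z; rewrite ![hmul _ x]hmulC; exact: h.
Qed.

Lemma hedge_neq0 u v w :
  [set u; v; w] \in E -> hmul (hmul (ha u) (ha v)) (ha w) <> hzero.
Proof.
move=> e /(congr1 hval); rewrite !hvalM !hval_cls -nmulA.
by rewrite -[neval (a u)]/(N1 u) -[neval (a v)]/(N1 v) -[neval (a w)]/(N1 w)
  nmul111 e.
Qed.

Definition hsemiring : semiring :=
  flat_semiring hmulA hmul0l hmul0r hmul_canc.

End HypergraphSemiring.

(** * Nested-type hypergraphs *)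

Section Nested.
Variable i : nat.

(* u_1, ..., u_(3i+3); the value of [nu j] is only meaningful for
   1 <= j <= 3i+3, which covers all the uses below. *)
Definition nu (j : nat) : 'I_(3 * i).+3 := inord j.-1.

Definition nested_edges : {set {set 'I_(3 * i).+3}} :=
  \bigcup_(1 <= k < i.+1)
    [set [set nu (3 * k - 1); nu (3 * k + 3); nu (3 * k - 2)];
         [set nu (3 * k - 2); nu (3 * k + 2); nu (3 * k)];
         [set nu (3 * k); nu (3 * k + 1); nu (3 * k - 1)]].

Lemma nested_edgesP e :
  reflect (exists2 k, 1 <= k <= i &
    [\/ e = [set nu (3 * k - 1); nu (3 * k + 3); nu (3 * k - 2)],
        e = [set nu (3 * k - 2); nu (3 * k + 2); nu (3 * k)] |
        e = [set nu (3 * k); nu (3 * k + 1); nu (3 * k - 1)]])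
  (e \in nested_edges).
Proof.
apply: (iffP idP) => [|[k kb he]].
  rewrite /nested_edges big_seq.
  elim/big_ind: _ => [|A B IA IB|k]; first by rewrite inE.
    by rewrite inE => /orP[/IA|/IB].
  rewrite mem_index_iota ltnS !inE => kb /orP[/orP[]|] /eqP he; exists k => //.
  - exact: Or31.
  - exact: Or32.
  - exact: Or33.
rewrite /nested_edges (big_rem k) /= ?mem_index_iota ?ltnS // !inE.
by case: he => ->; rewrite eqxx ?orbT.
Qed.

Lemma nuE (j : nat) (x : 'I_(3 * i).+3) : 0 < j <= 3 * i + 3 ->
  (x == nu j) = (j == x.+1).
Proof.
by move=> jb; rewrite -val_eqE /= inordK; lia.
Qed.

Lemma nested_card e : e \in nested_edges -> #|e| = 3.
Proof.
case/nested_edgesP => k kb; have h j x := @nuE j x.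
have card3 p q r : 0 < p <= 3 * i + 3 -> 0 < q <= 3 * i + 3 ->
    0 < r <= 3 * i + 3 -> p != q -> p != r -> q != r ->
    #|[set nu p; nu q; nu r]| = 3.
  move=> hp hq hr pq pr qr; rewrite setUC cardsU1 cards2 !inE.
  by rewrite !h // /nu !inordK; lia.
by case=> ->; apply: card3; lia.
Qed.

Lemma nested_linear e f : e \in nested_edges -> f \in nested_edges -> e != f ->
  #|e :&: f| <= 1.
Proof.
move=> he hf; apply: contraNT; rewrite -ltnNge => /card_gt1P[x [y []]].
rewrite !inE => /andP[xe xf] /andP[ye yf] ne; apply/eqP.
move: ne; rewrite -val_eqE /=.
case/nested_edgesP: he => k kb he; case/nested_edgesP: hf => l lb hf.
have [kl|kl] := eqVneq k l.
  rewrite -{l}kl in lb hf.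
  by case: he hf xe xf ye yf => -> [] -> //; rewrite !inE !nuE; lia.
by case: he hf xe xf ye yf => -> [] ->; rewrite !inE !nuE; lia.
Qed.

Lemma nested_cover : 0 < i ->
  forall v, exists2 e, e \in nested_edges & v \in e.
Proof.
move=> i0 v; have vb := ltn_ord v.
pose k := if v < 3 then 1 else v %/ 3.
have kb : 1 <= k <= i by rewrite /k; case: ifP; lia.
pose e1 := [set nu (3 * k - 1); nu (3 * k + 3); nu (3 * k - 2)].
pose e2 := [set nu (3 * k - 2); nu (3 * k + 2); nu (3 * k)].
pose e3 := [set nu (3 * k); nu (3 * k + 1); nu (3 * k - 1)].
have : [|| v \in e1, v \in e2 | v \in e3].
  rewrite !inE !nuE; [rewrite /k; case: ifP|..]; lia.
case/or3P => h; [exists e1|exists e2|exists e3] => //.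
all: apply/nested_edgesP; exists k => //.
- exact: Or31.
- exact: Or32.
- exact: Or33.
Qed.

Definition nested (i0 : 0 < i) : hypergraph3 :=
  Hypergraph3 nested_card nested_linear (nested_cover i0).

End Nested.

(* Main.v *)
(** Inclusion: the first [i + 1] layers of [N_(i+1)] induce [N_i], and [S_H] is
   a quotient of a subsemiring of [S_H'] whenever [H] is an induced
   subhypergraph of [H'].

   Strictness: take one variable per vertex of [N_(i+1)], and let [s] be the sum
   of the products of the edges.  In [S_(N_i)] an assignment makes [s] nonzero
   exactly when it is a homomorphism [N_(i+1) -> N_i], and then [s] takes the
   value [a].  Vertices of consecutive layers are joined in such a way that a
   homomorphism either sends the first layer to an edge, or sends each layer to
   a full layer, one step further each time.  The second case needs as many
   layers in the target as in the source.  Hence the identity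
   [s = s + x_0 x_1 x_2] holds in [S_(N_i)], while the generators of
   [S_(N_(i+1))] violate it. *)
Require Import Defs.
From mathcomp Require Import all_boot.
From mathcomp Require Import zify boolp.

Set Implicit Arguments.
Unset Strict Implicit.
Unset Printing Implicit Defensive.

(** * Identities and varieties *)

Inductive term := TVar of nat | TAdd of term & term | TMul of term & term.

Fixpoint teval (S : semiring) (x : nat -> S) (t : term) : S :=
  match t with
  | TVar n => x n
  | TAdd t u => sr_add (teval x t) (teval x u)
  | TMul t u => sr_mul (teval x t) (teval x u)
  end.

Definition satisfies (t u : term) (S : semiring) : Prop :=
  forall x : nat -> S, teval x t = teval x u.

Lemma teval_hom (A B : semiring) (f : A -> B) x t :
  sr_hom f -> f (teval x t) = teval (f \o x) t.
Proof. by case=> fD fM; elim: t => //= t <- u <-; rewrite ?fD ?fM. Qed.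

Lemma teval_prod (I : Type) (F : I -> semiring) (x : nat -> prod_semiring F)
    t i :
  teval x t i = teval (fun n => x n i) t.
Proof. by elim: t => //= t <- u <-. Qed.

(** The easy half of Birkhoff's theorem: one identity valid in a generator keeps every semiring that
    violates it out of the generated variety. *)
Lemma satisfies_variety t u : is_variety (satisfies t u).
Proof.
split.
- move=> A B f fH fS sA y.
  pose x n := proj1_sig (cid (fS (y n))).
  have -> : y = f \o x.
    by apply: funext => n; rewrite /x /=; case: cid => z /= ->.
  by rewrite -!teval_hom // sA.
- by move=> A B f fH fI sB x; apply: fI; rewrite !teval_hom.
- move=> I F sF x; apply: functional_extensionality_dep => i.
  by rewrite !teval_prod sF.
Qed.

(** * Subsemirings *)

Section Subsemiring.
Variables (S : semiring) (P : S -> Prop) (x0 : S).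
Hypotheses (Px0 : P x0)
  (PD : forall x y, P x -> P y -> P (sr_add x y))
  (PM : forall x y, P x -> P y -> P (sr_mul x y)).

Definition sub_add (x y : {x | P x}) : {x | P x} :=
  exist P _ (PD (svalP x) (svalP y)).
Definition sub_mul (x y : {x | P x}) : {x | P x} :=
  exist P _ (PM (svalP x) (svalP y)).

Lemma sub_val_inj : injective (@proj1_sig S P).
Proof. by case=> x px [y py] /= xy; exact: eq_exist. Qed.

Lemma sub_addA : associative sub_add.
Proof. by move=> x y z; apply: sub_val_inj; exact: sr_addA. Qed.

Lemma sub_addC : commutative sub_add.
Proof. by move=> x y; apply: sub_val_inj; exact: sr_addC. Qed.

Lemma sub_mulA : associative sub_mul.
Proof. by move=> x y z; apply: sub_val_inj; exact: sr_mulA. Qed.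

Lemma sub_mulDl : left_distributive sub_mul sub_add.
Proof. by move=> x y z; apply: sub_val_inj; exact: sr_mulDl. Qed.

Lemma sub_mulDr : right_distributive sub_mul sub_add.
Proof. by move=> x y z; apply: sub_val_inj; exact: sr_mulDr. Qed.

Definition subsemiring : semiring :=
  Semiring (inhabits (exist P x0 Px0)) sub_addA sub_addC sub_mulA
    sub_mulDl sub_mulDr.

Lemma subsemiring_hom : sr_hom (@proj1_sig S P : subsemiring -> S).
Proof. by []. Qed.

End Subsemiring.

Lemma variety_gen_mono (S S' : semiring) :
  variety_gen S' S -> forall T, variety_gen S T -> variety_gen S' T.
Proof. by move=> SS' T ST K vK KS'; apply: ST => //; exact: SS'. Qed.

(** * Sums and triple products in a hypergraph semiring *)

Section HypergraphSemiringTheory.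
Variable H : hypergraph3.
Implicit Types (x y : hsemiring H) (u v w : vert H).

Lemma hadd_neq0 x y : sr_add x y <> hzero H -> x = y.
Proof. by rewrite /= /flat_add; case: eqP. Qed.

Lemma haddxx x : sr_add x x = x.
Proof. by rewrite /= /flat_add eqxx. Qed.

Lemma hval0 : hval (hzero H) = N0 _.
Proof. exact: hval_cls. Qed.

Lemma hval_ha u : hval (ha u) = N1 u.
Proof. exact: hval_cls. Qed.

Lemma hval_ha3 u v w :
  hval (hmul (hmul (ha u) (ha v)) (ha w)) =
    if [set u; v; w] \in hedges H then N3 _ else N0 _.
Proof. by rewrite !hvalM !hval_ha -nmulA nmul111. Qed.

(** Give [N1], [N2], [N3] the degrees 1, 2, 3. Degrees add up in nonzero products and never exceed
    3, so all three factors are generators. *)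
Lemma hmul3_neq0 x y z :
  sr_mul (sr_mul x y) z <> hzero H ->
  exists u v w, [/\ [set u; v; w] \in hedges H, hval x = N1 u, hval y = N1 v,
    hval z = N1 w & hval (sr_mul (sr_mul x y) z : hsemiring H) = N3 _].
Proof.
move=> nz; have {nz} : hval (sr_mul (sr_mul x y) z : hsemiring H) <> N0 _.
  by rewrite -hval0 => /hval_inj.
rewrite /= !hvalM -nmulA.
case: (hval x) (hval y) (hval z) => [|u|h|] [|v|k|] [|w|l|] //.
all: try by rewrite /=; do ?[case: pickP => //= ? _ | case: eqP => //= _].
by rewrite nmul111; case: ifP => // e _; exists u, v, w.
Qed.

(** The vertex [v0] supplies an edge, without which [N3] would not be attained. *)
Lemma hval_surj (v0 : vert H) n : exists x, hval x = n.
Proof.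
have edge v : exists u w, [set u; w; v] \in hedges H.
  have [e eE ve] := hedges_cover v.
  have /eqP/cards2P[u [w [_ euw]]] : #|e :\ v| = 2.
    by have := cardsD1 v e; rewrite ve (hedges_card eE) => -[].
  by exists u, w; rewrite setUC -euw setD1K.
case: n => [|u|h|].
- by exists (hzero H); exact: hval0.
- by exists (ha u); exact: hval_ha.
- have [u [w e]] := edge h.
  by exists (hmul (ha u) (ha w)); rewrite hvalM !hval_ha (nmul11 e).
- have [u [w e]] := edge v0.
  by exists (hmul (hmul (ha u) (ha w)) (ha v0)); rewrite hval_ha3 e.
Qed.

End HypergraphSemiringTheory.

(** * Restriction to an induced subhypergraph *)

Section InducedSubhypergraph.
Variables (H H' : hypergraph3) (v0 : vert H) (f : vert H -> vert H').
Hypotheses (f_inj : injective f)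
  (f_edge : forall u v w,
    ([set f u; f v; f w] \in hedges H') = ([set u; v; w] \in hedges H)).

(** Only generators are restricted. Every [N2 h] stays, because two vertices in the image of [f] may
    lie in an edge whose third vertex [h] is outside it. *)
Definition induced (x : hsemiring H') : Prop :=
  if hval x is N1 v then exists u, v = f u else True.

Lemma induced0 : induced (hzero H').
Proof. by rewrite /induced hval0. Qed.

Lemma inducedD x y : induced x -> induced y -> induced (sr_add x y).
Proof.
by move=> px _; rewrite /= /flat_add; case: ifP => // _; exact: induced0.
Qed.

Lemma inducedM x y : induced x -> induced y -> induced (sr_mul x y).
Proof.
move=> _ _; rewrite /induced /= hvalM.
case: (hval x) (hval y) => [|u|h|] [|v|k|] //=.
- by case: pickP.
- by case: eqP.
- by case: eqP.
Qed.

Definition induced_semiring : semiring :=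
  subsemiring induced0 inducedD inducedM.

(* A product [N2 h] with [h] outside the image of [f] annihilates the whole
   subsemiring, so that it can be sent to zero. *)
Definition nrestr (n : nform H') : nform H :=
  match n with
  | N0 => N0 _
  | N1 v => if [pick u | f u == v] is Some u then N1 u else N0 _
  | N2 v => if [pick u | f u == v] is Some u then N2 u else N0 _
  | N3 => N3 _
  end.

Lemma pick_f u : [pick u' | f u' == f u] = Some u.
Proof. by case: pickP => [u' /eqP/f_inj->|/(_ u)] //; rewrite eqxx. Qed.

Lemma nrestrM12 u h :
  nrestr (nmul (N1 (f u)) (N2 h)) = nmul (nrestr (N1 (f u))) (nrestr (N2 h)).
Proof.
rewrite /= pick_f; case: pickP => [u' /eqP <-|n].
  by rewrite (inj_eq f_inj) /=; case: eqP.
by move: (n u); case: eqP.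
Qed.

Lemma nrestrM11 u v :
  nrestr (nmul (N1 (f u)) (N1 (f v))) =
    nmul (nrestr (N1 (f u))) (nrestr (N1 (f v))).
Proof.
have E w : nrestr (N1 (f w)) = N1 w by rewrite /= pick_f.
rewrite !E.
have [[h e ->]|[n ->]] := nmul11P u v.
  by rewrite (nmul11 (h := f h)) ?f_edge //= pick_f.
(* Here [u] and [v] share no edge of [H]. If their images share one, its third vertex is outside the
   image, and [nrestr] returns zero. *)
have [[h' e' ->]|[_ ->]] // := nmul11P (f u) (f v).
rewrite /=; case: pickP => // h /eqP hh'; move: e'.
by rewrite -hh' f_edge (negPf (n h)).
Qed.

Lemma nrestrM (x y : hsemiring H') : induced x -> induced y ->
  nrestr (nmul (hval x) (hval y)) = nmul (nrestr (hval x)) (nrestr (hval y)).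
Proof.
rewrite /induced; case: (hval x) (hval y) => [|u|h|] [|v|k|] //.
all: try by do ?[case=> ? ->]; rewrite /= ?pick_f; do ?case: pickP.
- by case=> u' -> [v' ->]; exact: nrestrM11.
- by case=> u' -> _; exact: nrestrM12.
- move=> _ [v' ->]; rewrite ![nmul _ (_ (N1 _))]nmulC [nmul (N2 _) _]nmulC.
  exact: nrestrM12.
Qed.

(** This makes the restriction additive: distinct elements have sum zero, so their images must not
    coincide in a nonzero value. *)
Lemma nrestr_inj (x y : hsemiring H') : induced x -> induced y ->
  nrestr (hval x) = nrestr (hval y) -> nrestr (hval x) <> N0 _ -> x = y.
Proof.
move=> px py e nz; apply: hval_inj; move: px py e nz.
rewrite /induced; case: (hval x) (hval y) => [|u|h|] [|v|k|] //=.
all: try by do ?case: pickP.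
- by case=> u' -> [v' ->]; rewrite !pick_f => -[->].
- by case: pickP => // u' /eqP<- _ _; case: pickP => // v' /eqP<- [->].
Qed.

Definition hrestr (x : induced_semiring) : hsemiring H :=
  proj1_sig (cid (hval_surj v0 (nrestr (hval (proj1_sig x))))).

Lemma hval_hrestr x : hval (hrestr x) = nrestr (hval (proj1_sig x)).
Proof. by rewrite /hrestr; case: cid. Qed.

Lemma hrestr_hom : sr_hom hrestr.
Proof.
split=> [[x px] [y py]|[x px] [y py]]; apply: hval_inj; last first.
  by rewrite [RHS]hvalM !hval_hrestr /= hvalM nrestrM.
have [xy|ne] := pselect (x = y).
  have -> : exist _ y py = exist _ x px by apply: sub_val_inj.
  by rewrite haddxx hval_hrestr /= /flat_add eqxx hval_hrestr.
rewrite hval_hrestr /= /flat_add; case: eqP => // _; rewrite hval0 /=.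
case: eqP => [e|_]; last by rewrite hval0.
move/(congr1 (@hval H)): (e); rewrite !hval_hrestr /= => e'.
have [->//|nz] := pselect (nrestr (hval x) = N0 _).
by case: ne; exact: nrestr_inj e' nz.
Qed.

Lemma hrestr_surj y : exists x, hrestr x = y.
Proof.
pose n' := match hval y with
  | N0 => N0 H' | N1 u => N1 (f u) | N2 u => N2 (f u) | N3 => N3 H' end.
have [x xn] := hval_surj (f v0) n'.
have px : induced x.
  by rewrite /induced xn /n'; case: (hval y) => // u; exists u.
exists (exist _ x px); apply: hval_inj; rewrite hval_hrestr /= xn /n'.
by case: (hval y) => //= u; rewrite pick_f.
Qed.

Lemma variety_gen_induced : variety_gen (hsemiring H') (hsemiring H).
Proof.
move=> K vK KH'; apply: (variety_quo vK hrestr_hom hrestr_surj).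
by apply: (variety_sub vK (subsemiring_hom _ _ _)) KH'; exact: sub_val_inj.
Qed.

End InducedSubhypergraph.

(** * Edges of nested hypergraphs by residue and layer *)

(* Vertices are numbered from 0, so that [x] is in layer [x %/ 3]. *)
Definition nested_triple (x y z : nat) : bool :=
  [&& x %% 3 != y %% 3, x %% 3 != z %% 3, y %% 3 != z %% 3 &
   [|| (x %/ 3 == y %/ 3) && (z %/ 3 == (x %/ 3).+1),
       (y %/ 3 == z %/ 3) && (x %/ 3 == (y %/ 3).+1) |
       (z %/ 3 == x %/ 3) && (y %/ 3 == (z %/ 3).+1)]].

Lemma nested_tripleP x y z : nested_triple x y z <->
  (x %% 3 <> y %% 3 /\ x %% 3 <> z %% 3 /\ y %% 3 <> z %% 3) /\
  (x %/ 3 = y %/ 3 /\ z %/ 3 = (x %/ 3).+1 \/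
   y %/ 3 = z %/ 3 /\ x %/ 3 = (y %/ 3).+1 \/
   z %/ 3 = x %/ 3 /\ y %/ 3 = (z %/ 3).+1).
Proof.
split.
  case/and4P => /eqP xy /eqP xz /eqP yz /or3P[] /andP[/eqP e /eqP e'].
  - by split=> //; left.
  - by split=> //; right; left.
  - by split=> //; right; right.
case=> -[/eqP xy [/eqP xz /eqP yz]] L; rewrite /nested_triple xy xz yz /=.
by case: L => [[-> ->]|[[-> ->]|[-> ->]]]; rewrite !eqxx ?orbT.
Qed.

Lemma nested_triple_adj x y z : nested_triple x y z ->
  x %/ 3 <= (y %/ 3).+1 /\ y %/ 3 <= (x %/ 3).+1.
Proof. by case/nested_tripleP => _; lia. Qed.

Lemma nested_triple_shift k x y z :
  nested_triple (3 * k + x) (3 * k + y) (3 * k + z) = nested_triple x y z.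
Proof.
by rewrite /nested_triple !(mulnC 3) !modnMDl !divnMDl // -!addnS !eqn_add2l.
Qed.

Lemma nested_edges_sub i (u v w : 'I_(3 * i).+3) :
  [set u; v; w] \in nested_edges i -> nested_triple u v w.
Proof.
move=> e; have := nested_card e; rewrite setUC cardsU1 cards2 !inE => d.
have {d} /and3P[uv uw vw] : [&& u != v, u != w & v != w].
  by move: d; rewrite (eq_sym w u) (eq_sym w v); do 3!case: (_ == _).
have [ue ve we] : [/\ u \in [set u; v; w], v \in [set u; v; w] &
    w \in [set u; v; w]] by rewrite !inE !eqxx !orbT.
case/nested_edgesP: e ue ve we => -[//|k] kb E.
(* The edge index is now [k.+1], and [nu] counts from 1, so the lists hold the offsets of zero-based
   vertices from [3 * k]. *)
have [s ds ins] :
    exists2 s, s \in [:: [:: 1; 5; 0]; [:: 0; 4; 2]; [:: 2; 3; 1]] &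
    forall x, x \in [set u; v; w] -> exists2 c, c \in s & x = 3 * k + c :> nat.
  case: E => ->;
    [exists [:: 1; 5; 0]|exists [:: 0; 4; 2]|exists [:: 2; 3; 1]] => // x;
    rewrite !inE !nuE; try lia; case/orP => [/orP[]|] /eqP xE;
    [exists 1|exists 5|exists 0|exists 0|exists 4|exists 2
    |exists 2|exists 3|exists 1] => //; lia.
move=> /ins[a ia ua] /ins[b ib vb] /ins[c ic wc].
move: uv uw vw; rewrite -!val_eqE /= ua vb wc nested_triple_shift !eqn_add2l.
move: ds ia ib ic; rewrite !inE => /or3P[] /eqP->; rewrite !inE;
  by do 3!case/or3P => /eqP->.
Qed.

Local Ltac set_perm :=
  by apply/setP => ?; rewrite !inE; do 3!case: (_ == _).

Lemma nested_edges_outer i (u v w : 'I_(3 * i).+3) :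
  u %% 3 != v %% 3 -> u %% 3 != w %% 3 -> v %% 3 != w %% 3 ->
  u %/ 3 = v %/ 3 -> w %/ 3 = (u %/ 3).+1 ->
  [set u; v; w] \in nested_edges i.
Proof.
move=> uv uw vw luv lw; have wb := ltn_ord w.
apply/nested_edgesP; exists (u %/ 3).+1; first lia.
have N (x : 'I_(3 * i).+3) c : x.+1 = c -> x = nu i c.
  by move=> <-; rewrite /nu inord_val.
have uN : u = nu i (3 * (u %/ 3) + (u %% 3).+1) by apply: N; lia.
have vN : v = nu i (3 * (u %/ 3) + (v %% 3).+1) by apply: N; lia.
(* The next layer adds 3, and the numbering of [nu] from 1 adds another 1. *)
have wN : w = nu i (3 * (u %/ 3) + (w %% 3).+4) by apply: N; lia.
rewrite [in [set u; v; w]]uN [in [set _; v; w]]vN [in [set _; _; w]]wN.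
have -> : 3 * (u %/ 3).+1 - 1 = 3 * (u %/ 3) + 2 by lia.
have -> : 3 * (u %/ 3).+1 - 2 = 3 * (u %/ 3) + 1 by lia.
have -> : 3 * (u %/ 3).+1 = 3 * (u %/ 3) + 3 by lia.
rewrite -!(addnA (_ * _)) !addSn !add0n.
move: uv uw vw (ltn_pmod u (isT : 0 < 3)) (ltn_pmod v (isT : 0 < 3))
  (ltn_pmod w (isT : 0 < 3)).
move: (3 * (u %/ 3)) (u %% 3) (v %% 3) (w %% 3) => k.
case=> [|[|[|?]]] [|[|[|?]]] [|[|[|?]]] // _ _ _ _ _ _.
(* Six arrangements of distinct residues remain, two for each edge of the layer. *)
all: first [apply: Or31; set_perm | apply: Or32; set_perm
           | apply: Or33; set_perm].
Qed.

Lemma nested_edgesE i (u v w : 'I_(3 * i).+3) :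
  ([set u; v; w] \in nested_edges i) = nested_triple u v w.
Proof.
apply/idP/idP; first exact: nested_edges_sub.
case/and4P => uv uw vw /or3P[] /andP[/eqP e /eqP e'].
- exact: nested_edges_outer.
- by rewrite -setUA setUC; apply: nested_edges_outer => //; lia.
- by rewrite setUC setUA; apply: nested_edges_outer => //; lia.
Qed.

(** * Homomorphisms into a nested hypergraph with fewer layers *)

(** Otherwise layer 0 lands inside a single layer. Each edge then lifts its third vertex one layer
    higher, until layer [i.+1] exceeds the bound on [g]. *)
Lemma nested_hom_collapse i (g : nat -> nat) :
  0 < i -> (forall m, g m < 3 * i + 3) ->
  (forall j, j <= i ->
    [/\ nested_triple (g (3 * j)) (g (3 * j + 1)) (g (3 * j + 5)),
        nested_triple (g (3 * j)) (g (3 * j + 2)) (g (3 * j + 4)) &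
        nested_triple (g (3 * j + 1)) (g (3 * j + 2)) (g (3 * j + 3))]) ->
  nested_triple (g 0) (g 1) (g 2).
Proof.
move=> i0 gb E; apply/negPn/negP => n.
have L j : j <= i -> exists l, [/\ j <= l, g (3 * j) %/ 3 = l,
    g (3 * j + 1) %/ 3 = l & g (3 * j + 2) %/ 3 = l].
  elim: j => [_|j IH ji].
    have [/nested_tripleP[[c01 _] A1] /nested_tripleP[[c02 _] A2]
        /nested_tripleP[[c12 _] A3]] : [/\ nested_triple (g 0) (g 1) (g 5),
      nested_triple (g 0) (g 2) (g 4) & nested_triple (g 1) (g 2) (g 3)]
      := E 0 (leq0n i).
    have [/nested_triple_adj B1 /nested_triple_adj B2
        /nested_triple_adj B3] : [/\ nested_triple (g 3) (g 4) (g 8),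
      nested_triple (g 3) (g 5) (g 7) & nested_triple (g 4) (g 5) (g 6)]
      := E 1 i0.
    (* The residues are already distinct, so only the layer pattern can fail. *)
    have n' := contra_not (fun L => (nested_tripleP _ _ _).2
      (conj (conj c01 (conj c02 c12)) L)) (elimN idP n).
    exists (g 0 %/ 3); rewrite muln0 !add0n.
    (* The layers of [g 0], [g 1], [g 2] differ by at most one. One below two would put two of
       [g 3], [g 4], [g 5] two layers apart, against the edges of layer 1. *)
    move: (g 0 %/ 3) (g 1 %/ 3) (g 2 %/ 3) (g 3 %/ 3) (g 4 %/ 3) (g 5 %/ 3)
      A1 A2 A3 B1 B2 B3 n'.
    by clear => *; split; lia.
  have [l [jl e0 e1 e2]] := IH (ltnW ji); exists l.+1.
  have [/nested_tripleP[_ A1] /nested_tripleP[_ A2] /nested_tripleP[_ A3]] :=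
    E j (ltnW ji).
  have -> : 3 * j.+1 = 3 * j + 3 by lia.
  have -> : 3 * j + 3 + 1 = 3 * j + 4 by lia.
  have -> : 3 * j + 3 + 2 = 3 * j + 5 by lia.
  split; lia.
have [l [il e0 e1 e2]] := L i (leqnn i).
have [_ _ /nested_tripleP[_ A]] := E i (leqnn i).
have := gb (3 * i + 3); lia.
Qed.

(** * The separating identity *)

Definition prod3 (a b c : nat) : term := TMul (TMul (TVar a) (TVar b)) (TVar c).

Definition layer_term (j : nat) : term :=
  TAdd (TAdd (prod3 (3 * j) (3 * j + 1) (3 * j + 5))
             (prod3 (3 * j) (3 * j + 2) (3 * j + 4)))
       (prod3 (3 * j + 1) (3 * j + 2) (3 * j + 3)).

(** Layers [0] to [n] inclusive, hence all edges of the nested hypergraph of index [n.+1]. *)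
Fixpoint nested_term (n : nat) : term :=
  if n is m.+1 then TAdd (nested_term m) (layer_term n) else layer_term 0.

Lemma teval_add_neq0 (H : hypergraph3) (x : nat -> hsemiring H) t u :
  teval x (TAdd t u) <> hzero H ->
  teval x t = teval x (TAdd t u) /\ teval x u = teval x (TAdd t u).
Proof.
move=> nz; have e : teval x t = teval x u := hadd_neq0 nz.
by rewrite -[teval x (TAdd t u)]/(sr_add (teval x t) (teval x u)) e haddxx.
Qed.

Lemma nested_term_neq0 (H : hypergraph3) (x : nat -> hsemiring H) n :
  teval x (nested_term n) <> hzero H -> forall j, j <= n ->
  let s := teval x (nested_term n) in
  [/\ teval x (prod3 (3 * j) (3 * j + 1) (3 * j + 5)) = s,
      teval x (prod3 (3 * j) (3 * j + 2) (3 * j + 4)) = s &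
      teval x (prod3 (3 * j + 1) (3 * j + 2) (3 * j + 3)) = s].
Proof.
have layer j : let s := teval x (layer_term j) in s <> hzero H ->
    [/\ teval x (prod3 (3 * j) (3 * j + 1) (3 * j + 5)) = s,
        teval x (prod3 (3 * j) (3 * j + 2) (3 * j + 4)) = s &
        teval x (prod3 (3 * j + 1) (3 * j + 2) (3 * j + 3)) = s].
  move=> s; rewrite {}/s.
  rewrite /layer_term => nz; have [e e3] := teval_add_neq0 nz.
  by move: nz; rewrite -[in X in X -> _]e => /teval_add_neq0[e1 e2];
    split; rewrite // -e.
elim: n => [|n IH] nz j.
  by rewrite leqn0 => /eqP-> s; exact: layer.
have [e1 e2] := teval_add_neq0 nz; rewrite -[nested_term n.+1]/(TAdd _ _).
rewrite leq_eqVlt => /orP[/eqP->|jn] s; rewrite {}/s.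
  by rewrite -e2; apply: layer; rewrite e2.
by rewrite -e1; apply: IH => //; rewrite e1.
Qed.

Lemma nested_term_eq (H : hypergraph3) (x : nat -> hsemiring H) c n :
  (forall j, j <= n -> teval x (layer_term j) = c) ->
  teval x (nested_term n) = c.
Proof.
elim: n => [|n IH] h; first exact: h.
rewrite -[nested_term n.+1]/(TAdd _ (layer_term n.+1)).
rewrite -[LHS]/(sr_add (teval x (nested_term n)) (teval x (layer_term n.+1))).
by rewrite IH => [|j jn]; rewrite h ?haddxx // ltnW.
Qed.

Lemma nested_satisfies i (i0 : 0 < i) :
  satisfies (nested_term i) (TAdd (nested_term i) (prod3 0 1 2))
    (hsemiring (nested i0)).
Proof.
move=> x; set s := teval x _.
rewrite -[RHS]/(sr_add s (teval x (prod3 0 1 2))).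
have [s0|snz] := pselect (s = hzero _).
  by rewrite s0 /= /flat_add; case: eqP.
(* The default 0 makes the bound hold for every [m]. It does not affect [P], where all factors are
   generators. *)
pose g m : nat := if hval (x m) is N1 u then u else 0.
have gb m : g m < 3 * i + 3.
  by rewrite /g addn3; case: (hval (x m)) => // u; exact: ltn_ord.
have P a b c : teval x (prod3 a b c) = s ->
    nested_triple (g a) (g b) (g c) /\ hval s = N3 _.
  move=> e; move: snz; rewrite -e => /hmul3_neq0[u [v [w [ed ua vb wc s3]]]].
  by split; [rewrite /g ua vb wc -nested_edgesE | exact: s3].
have E := nested_term_neq0 snz; rewrite -/s in E.
have s3 : hval s = N3 _ by have [/P[]] := E 0 isT.
have C : nested_triple (g 0) (g 1) (g 2).
  apply: (nested_hom_collapse i0 gb) => j ji.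
  by have [/P[? _] /P[? _] /P[? _]] := E j ji.
rewrite (_ : teval x (prod3 0 1 2) = s) ?haddxx //.
(* Because of its default, [g] cannot tell that these three values are generators; the edges [0 1 5]
   and [0 2 4] can. *)
have /and3P[g0 g1 g2] : [&& if hval (x 0) is N1 _ then true else false,
    if hval (x 1) is N1 _ then true else false &
    if hval (x 2) is N1 _ then true else false].
  have [e1 e2 _] := E 0 isT.
  have /hmul3_neq0[u [v [w [_ -> -> _ _]]]] : teval x (prod3 0 1 5) <> hzero _.
    by rewrite [teval _ _]e1.
  have /hmul3_neq0[u' [v' [w' [_ _ -> _ _]]]] :
      teval x (prod3 0 2 4) <> hzero _.
    by rewrite [teval _ _]e2.
  by [].
apply: hval_inj; rewrite s3 -[teval _ _]/(hmul (hmul _ _) _) !hvalM -nmulA.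
move: C g0 g1 g2; rewrite /g.
case: (hval (x 0)) (hval (x 1)) (hval (x 2)) =>
  [|u|?|] [|v|?|] [|w|?|] // C _ _ _.
by rewrite nmul111 [hedges _]/(nested_edges _) nested_edgesE C.
Qed.

(** Send each variable to the generator of its vertex: every edge product has normal form [N3], but
    vertices 0, 1, 2 share a layer and form no edge. *)
Lemma nested_not_satisfies i :
  ~ satisfies (nested_term i) (TAdd (nested_term i) (prod3 0 1 2))
    (hsemiring (nested (ltn0Sn i))).
Proof.
pose H := nested (ltn0Sn i).
pose x m : hsemiring H := ha (nu i.+1 m.+1 : vert H).
have [c c3] := @hval_surj H ord0 (N3 _).
have xE a b d : a <= 3 * i + 5 -> b <= 3 * i + 5 -> d <= 3 * i + 5 ->
    hval (teval x (prod3 a b d)) = if nested_triple a b d then N3 _ else N0 _.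
  move=> ha hb hd; rewrite -[teval _ _]/(hmul (hmul (x _) (x _)) (x _)).
  rewrite hval_ha3 -[hedges H]/(nested_edges _) nested_edgesE.
  by rewrite /nu /= !inordK //; lia.
have s3 : teval x (nested_term i) = c.
  apply: nested_term_eq => j ji.
  have e a b d : a <= 3 * i + 5 -> b <= 3 * i + 5 -> d <= 3 * i + 5 ->
      nested_triple a b d -> teval x (prod3 a b d) = c.
    by move=> a5 b5 d5 t; apply: hval_inj; rewrite xE // c3 t.
  rewrite -[LHS]/(sr_add (sr_add (teval x (prod3 _ _ _))
    (teval x (prod3 _ _ _))) (teval x (prod3 _ _ _))).
  have t0 y z := nested_triple_shift j 0 y z; rewrite addn0 in t0.
  by rewrite !e ?haddxx ?t0 ?nested_triple_shift //; lia.
move/(_ x); rewrite -[RHS]/(sr_add (teval x (nested_term i)) _) s3 => h.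
have nz : c <> hzero H by move=> c0; move: c3; rewrite c0 hval0.
have e : c = teval x (prod3 0 1 2) by apply: hadd_neq0; rewrite -h.
by move: c3; rewrite e xE //; lia.
Qed.

Theorem proposition4p5 (i : nat) (hi : 1 <= i) :
  (forall T : semiring,
     variety_gen (hsemiring (nested hi)) T ->
     variety_gen (hsemiring (nested (ltn0Sn i))) T) /\
  (exists T : semiring,
     variety_gen (hsemiring (nested (ltn0Sn i))) T /\
     ~ variety_gen (hsemiring (nested hi)) T).
Proof.
split.
  have le : (3 * i).+3 <= (3 * i.+1).+3 by lia.
  apply: variety_gen_mono.
  (* Edges depend only on the numerical values of vertices, which [widen_ord] preserves. *)
  apply: (@variety_gen_induced (nested hi) (nested (ltn0Sn i)) ord0
    (widen_ord le)).
    by move=> u v /(congr1 val) /= /val_inj.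
  by move=> u v w; rewrite /= !nested_edgesE.
exists (hsemiring (nested (ltn0Sn i))); split=> [K _ //|h].
apply: (@nested_not_satisfies i).
exact: (h _ (satisfies_variety _ _) (@nested_satisfies i hi)).
Qed.
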